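(* Let $d\ge1$ be an integer and let $G$ be a graph of girth at least $6$ with fractional chromatic number $\chi_f(G)\ge 8.1d$. Let $p=|V(G)|$, let $q\ge 2^{p-1}p^2$ be an integer and $c=4q+2$. Then $\chi(G[K_q])\ge 2dc-2c+2$ and $\chi\big(K_{dc}^{G[K_q]}\big)\ge 2dc-2c+2$. Consequently $f(2dc-2c+2)\le dc$.
   Context: $[m]=\{1,\dots,m\}$. $G[K_q]$ has vertex set $V(G)\times[q]$, with $(x,i)\sim(y,j)$ iff $xy\in E(G)$, or $x=y$ and $i\ne j$. For a graph $F$, $K_m^{F}$ has as vertices all maps $V(F)\to[m]$, with $f\sim g$ iff $f(x)\ne g(y)$ and $f(y)\ne g(x)$ for every edge $xy$ of $F$. The product $G\times H$ has vertex set $V(G)\times V(H)$ with $(x,y)\sim(x',y')$ iff $xx'\in E(G)$ and $yy'\in E(H)$. The Poljak–Rödl function is $f(n)=\min\{\chi(G\times H): \chi(G)=\chi(H)=n\}$ (equivalently with $\chi(G),\chi(H)\ge n$). *)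

(* Defs.v *)
From HB Require Import structures.
From mathcomp Require Import all_boot all_order all_algebra.
Set Implicit Arguments. Unset Strict Implicit. Unset Printing Implicit Defensive.
Import Order.TTheory GRing.Theory Num.Theory.

Definition simple_graph (T : finType) (e : rel T) : Prop :=
  symmetric e /\ irreflexive e.

Definition colorable (T : finType) (e : rel T) (k : nat) : bool :=
  [exists f : {ffun T -> 'I_k}, [forall x, forall y, e x y ==> (f x != f y)]].

(* chi(G) >= n : no proper colouring with fewer than n colours
   (chi = +infinity if no proper colouring exists, e.g. with loops) *)
Definition chi_ge (T : finType) (e : rel T) (n : nat) : Prop :=
  forall k, k < n -> ~~ colorable e k.

Definition chi_le (T : finType) (e : rel T) (m : nat) : Prop := colorable e m.

Definition girth_ge6 (T : finType) (e : rel T) : Prop :=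
  forall s : seq T, uniq s -> 3 <= size s <= 5 -> ~~ cycle e s.

Definition independent (T : finType) (e : rel T) (A : {set T}) : bool :=
  [forall x in A, forall y in A, ~~ e x y].

Definition frac_coloring (T : finType) (e : rel T) (w : {ffun {set T} -> rat}) : Prop :=
  (forall A, 0 <= w A)%R /\ (forall A, w A != 0%R -> independent e A) /\
  (forall x : T, 1 <= \sum_(A : {set T} | x \in A) w A)%R.

Definition frac_chi_ge (T : finType) (e : rel T) (r : rat) : Prop :=
  forall w, frac_coloring e w -> (r <= \sum_(A : {set T}) w A)%R.

Definition lex_Kq (T : finType) (e : rel T) (q : nat) : rel (T * 'I_q) :=
  fun u v => e u.1 v.1 || ((u.1 == v.1) && (u.2 != v.2)).

Definition exp_graph (T : finType) (e : rel T) (m : nat) : rel {ffun T -> 'I_m} :=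
  fun f g => [forall x, forall y, e x y ==> ((f x != g y) && (f y != g x))].

Definition prod_graph (T1 T2 : finType) (e1 : rel T1) (e2 : rel T2) : rel (T1 * T2) :=
  fun u v => e1 u.1 v.1 && e2 u.2 v.2.

Definition poljak_rodl_le (n m : nat) : Prop :=
  exists (T1 T2 : finType) (e1 : rel T1) (e2 : rel T2),
    [/\ simple_graph e1, simple_graph e2, chi_ge e1 n, chi_ge e2 n &
        chi_le (prod_graph e1 e2) m].

Arguments lex_Kq {T} e q _ _.
Arguments exp_graph {T} e m _ _.
Arguments colorable {T} e k.

(* Main.v *)
Require Import Defs.
From HB Require Import structures.
From mathcomp Require Import all_boot all_order all_algebra all_fingroup.
From mathcomp Require Import zify.
Import Order.TTheory GRing.Theory Num.Theory.

(** Write Gamma for G[K_q].  A proper colouring of K_{dc}^Gamma gives distinct colours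
    to the dc constant maps.  By Shitov's argument, for every c-subset S of [dc] some map
    with values in S gets a colour t(S) that no constant map has.  Maps with values in
    disjoint sets are adjacent, so t is a proper colouring of the Kneser graph KG(dc, c),
    and by Lovasz's theorem it uses at least dc - 2c + 2 colours.

    Lovasz's theorem is derived from the octahedral Tucker lemma, which follows from a
    parity count of maximal chains with alternating labels, as in Ky Fan's lemma. *)

Set Implicit Arguments.
Unset Strict Implicit.
Unset Printing Implicit Defensive.

Local Open Scope nat_scope.

(** * The octahedral Tucker lemma *)

(** The map [f] splits [P] into pairs on which [F] agrees, and these cancel modulo 2. Comparing
    [enum_rank] picks one element of each pair. *)
Lemma addb_involution_false (T : finType) (P F : pred T) (f : T -> T) :
  {in P, involutive f} -> {in P, forall x, f x \in P} ->
  {in P, forall x, f x != x} -> {in P, forall x, F (f x) = F x} ->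
  \big[addb/false]_(x in P) F x = false.
Proof.
move=> fK fP fne Ff.
rewrite (bigID (fun x => enum_rank x < enum_rank (f x))) /=.
rewrite [X in _ (+) X](_ : _ =
  \big[addb/false]_(x in P | enum_rank x < enum_rank (f x)) F x) ?addbb //.
rewrite [RHS](eq_bigr (fun x => F (f x))) => [|x /andP[/Ff->]] //.
pose g x := if x \in P then f x else x.
have gK : involutive g.
  move=> x; rewrite /g; case: (boolP (x \in P)) => xP; first by rewrite fP // fK.
  by rewrite (negPf xP).
rewrite [LHS](reindex_inj (inv_inj gK)) /=.
apply: eq_big => x; rewrite /g; case: ifP => // xP; rewrite ?xP //=.
rewrite fP // fK //= -leqNgt leq_eqVlt.
by rewrite val_eqE (inj_eq enum_rank_inj) eq_sym (negPf (fne x xP)).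
Qed.

(** * Alternating sign words and their deletions *)

Fixpoint alternating (s : bool) (B : seq bool) : bool :=
  if B is b :: B' then (b == s) && alternating (~~ s) B' else true.

Lemma alternating_negb s B : alternating s (map negb B) = alternating (~~ s) B.
Proof. by elim: B s => //= b B IH s; rewrite IH; case: b; case: s. Qed.

(* The label with absolute value a and sign b is encoded as the number 2 a + b. *)
Definition alternating_labels s (L : seq nat) := alternating s (map odd (sort leq L)).

Lemma rem_sorted_cons (b x : nat) S :
  sorted leq (b :: S) -> x \in S -> rem x (b :: S) = b :: rem x S.
Proof.
rewrite /=; case: eqP => // -> ; case: S => //= y S /andP[le_by pS].
rewrite inE; case: eqP => [->|/eqP ne_by] //=; rewrite ?eqxx //.
move/(allP (order_path_min leq_trans pS)) => /= le_yb.
by case/eqP: ne_by; apply/eqP; rewrite eqn_leq le_yb le_by.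
Qed.

(** For a nonempty word alternating from [s], only deleting the last letter leaves a word
    alternating from [s]; for one alternating from [~~ s], only deleting the first does. Any other
    word has no such deletion, or two from its single pair of equal adjacent signs. *)
Lemma alternating_rem_sorted s S : sorted leq S ->
  \big[addb/false]_(x <- S) alternating s (map odd (rem x S)) =
  alternating s (map odd S) (+) alternating (~~ s) (map odd S).
Proof.
elim: S s => [|b S IH] s sS; first by rewrite big_nil.
have remb : rem b (b :: S) = S by rewrite /= eqxx.
rewrite big_cons remb.
rewrite big_seq
  (eq_bigr (fun x => (odd b == s) && alternating (~~ s) (map odd (rem x S)))); last first.
  by move=> x xS; rewrite (rem_sorted_cons sS xS).
rewrite -big_seq -big_distrr [in LHS]/= IH ?(path_sorted sS) //= !negbK.
case: s {IH} => /=; move: (alternating true _) (alternating false (map odd S)) => u v;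
  by case: (odd b); case: u; case: v.
Qed.

Lemma sort_perm (L L' : seq nat) : perm_eq L L' -> sort leq L = sort leq L'.
Proof. by move/(perm_sortP leq_total leq_trans anti_leq). Qed.

Lemma alternating_labels_rem (I : eqType) (lab : I -> nat) s (J : seq I) :
  \big[addb/false]_(j <- J) alternating_labels s (map lab (rem j J)) =
  alternating_labels s (map lab J) (+) alternating_labels (~~ s) (map lab J).
Proof.
set L := map lab J.
have sS : sorted leq (sort leq L) by apply: sort_sorted; exact: leq_total.
rewrite -(alternating_rem_sorted s sS).
rewrite (perm_big _ (permEl (perm_sort leq L))) big_map.
rewrite big_seq [RHS]big_seq; apply: eq_bigr => j jJ; congr (alternating _ (map _ _)).
have -> : rem (lab j) (sort leq L) = sort leq (rem (lab j) (sort leq L)).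
  rewrite [RHS](sorted_sort leq_trans) //.
  exact: (subseq_sorted leq_trans (rem_subseq _ _) sS).
apply: sort_perm; rewrite -(perm_cons (lab j)) -map_cons.
have jL : lab j \in sort leq L by rewrite mem_sort map_f.
rewrite perm_sym -(permPl (perm_to_rem jL)) perm_sort.
exact: (perm_map lab (perm_to_rem jJ)).
Qed.

Definition opp_label l := if odd l then l.-1 else l.+1.

Lemma odd_opp_label l : odd (opp_label l) = ~~ odd l.
Proof. by rewrite /opp_label; case: ifP => //= ol; [case: l ol => //= l /negPf|]; rewrite ?ol. Qed.

Lemma opp_label_homo x y : y <> opp_label x -> x <= y -> opp_label x <= opp_label y.
Proof. by rewrite /opp_label; do 2 case: ifP; lia. Qed.

(** Without complementary labels, equal absolute values mean equal labels, so negation keeps the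
    sorted order. *)
Lemma alternating_labels_opp s L :
  {in L &, forall x y, y <> opp_label x} ->
  alternating_labels s (map opp_label L) = alternating_labels (~~ s) L.
Proof.
move=> nc; rewrite /alternating_labels.
have -> : sort leq (map opp_label L) = map opp_label (sort leq L).
  have pL : perm_eq L (sort leq L) by rewrite perm_sym perm_sort.
  transitivity (sort leq (map opp_label (sort leq L))).
    exact: sort_perm (perm_map opp_label pL).
  apply: (sorted_sort leq_trans).
  rewrite sorted_map; have := sort_sorted leq_total L.
  apply: (@sub_in_sorted _ (mem L)); last by apply/allP => x; rewrite mem_sort.
  by move=> x y xL yL /=; apply: opp_label_homo; exact: nc.
rewrite -alternating_negb -!map_comp; congr alternating; apply: eq_map => l /=.
by rewrite odd_opp_label.
Qed.

(** Neighbours in the sorted list differ in sign and are not complementary, so their absolute values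
    increase strictly, staying below [m]. *)
Lemma alternating_labels_size s L m :
  {in L &, forall x y, y <> opp_label x} -> {in L, forall x, x < m.*2} ->
  alternating_labels s L -> size L <= m.
Proof.
move=> nc ub altL.
have uS : uniq (map half (sort leq L)).
  have nc' : {in sort leq L &, forall x y, y <> opp_label x}.
    by move=> x y; rewrite !mem_sort; exact: nc.
  have sS := sort_sorted leq_total L.
  apply: (sorted_uniq ltn_trans ltnn).
  move: altL sS nc'; rewrite /alternating_labels; elim: (sort leq L) s => //= x S IH s.
  case: S IH => //= y S IH /and3P[/eqP ox /eqP oy aS] /andP[le_xy pS] ncS.
  apply/andP; split; last first.
    apply: (IH (~~ s)) => //; first by rewrite oy eqxx.
    by move=> u v uS vS; apply: ncS; rewrite inE ?uS ?vS orbT.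
  have := ncS x y; rewrite !inE !eqxx orbT => /(_ isT isT).
  by rewrite /opp_label ox; case: s ox oy aS IH => ox oy _ _; rewrite ?ox ?oy; lia.
rewrite -(size_sort leq) -(size_map half) -(size_iota 0 m).
apply: uniq_leq_size => // z /mapP[x]; rewrite mem_sort => /ub lt_x ->.
by rewrite mem_iota /=; lia.
Qed.

(** * Maximal chains of signed sets *)

Section Tucker.
Variables (n m : nat) (lam : {set 'I_n} -> {set 'I_n} -> nat).

(* (p, s) encodes a maximal chain: p is the position at which a coordinate
   enters and s its sign. *)
Local Notation flag := ({perm 'I_n} * {ffun 'I_n -> bool})%type.

Definition flag_part (f : flag) (b : bool) (j : nat) : {set 'I_n} :=
  [set x | (f.1 x < j) && (f.2 x == b)].

(** The shift by one skips the empty pair: [j] indexes the chain member with [j + 1] coordinates. *)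
Definition flag_label (f : flag) (j : nat) : nat :=
  lam (flag_part f true j.+1) (flag_part f false j.+1).

(* Flags of the sphere of the first k coordinates, padded by positive coordinates in order. *)
Definition subsphere_flag (k : nat) : pred flag :=
  fun f => [forall x : 'I_n, (k <= x) ==> (f.1 x == x) && f.2 x].

Definition flag_alternating (b : bool) (k : nat) (f : flag) :=
  alternating_labels b (map (flag_label f) (iota 0 k)).

Hypothesis lam_opp : forall A B : {set 'I_n}, [disjoint A & B] -> A :|: B != set0 ->
  lam B A = opp_label (lam A B).
Hypothesis lam_compl : forall A B A' B' : {set 'I_n}, A \subset A' -> B \subset B' ->
  [disjoint A' & B'] -> A :|: B != set0 -> lam A' B' <> opp_label (lam A B).

Lemma subsphere_flagP k (f : flag) :
  reflect (forall x : 'I_n, k <= x -> f.1 x = x /\ f.2 x = true) (subsphere_flag k f).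
Proof.
apply: (iffP forallP) => [H x kx | H x].
  by have := H x; rewrite kx /= => /andP[/eqP-> ->].
by apply/implyP => /H[-> ->]; rewrite eqxx.
Qed.

Lemma flag_part_disjoint f j : [disjoint flag_part f true j & flag_part f false j].
Proof.
by rewrite -setI_eq0; apply/eqP/setP => x; rewrite !inE; case: (f.2 x); rewrite ?andbF.
Qed.

Lemma flag_part_neq0 f (j : nat) : j < n ->
  flag_part f true j.+1 :|: flag_part f false j.+1 != set0.
Proof.
move=> jn; apply/set0Pn; exists (f.1^-1 (Ordinal jn))%g.
by rewrite !inE permKV /= ltnSn /=; case: (f.2 _).
Qed.

Lemma flag_part_sub f b i j : i <= j -> flag_part f b i \subset flag_part f b j.
Proof.
by move=> ij; apply/subsetP => x; rewrite !inE => /andP[lt_xi ->]; rewrite (leq_trans lt_xi).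
Qed.

Lemma flag_label_compl f i j : i < n -> j < n -> flag_label f j <> opp_label (flag_label f i).
Proof.
move=> lin ljn; have [le_ij|lt_ji] := leqP i j.
  by apply: lam_compl; rewrite ?flag_part_sub ?flag_part_disjoint ?flag_part_neq0.
move=> E; have := @lam_compl (flag_part f true j.+1) (flag_part f false j.+1)
  (flag_part f true i.+1) (flag_part f false i.+1).
rewrite !flag_part_sub ?flag_part_disjoint ?flag_part_neq0 //; try lia.
move/(_ isT isT isT isT); apply; move: E; rewrite /flag_label => ->.
by rewrite /opp_label; do 2 case: ifP; lia.
Qed.

(** The antipodal map on the sphere of the first [k] coordinates. *)
Definition flag_flip (k : nat) (f : flag) : flag :=
  (f.1, [ffun x : 'I_n => if x < k then ~~ f.2 x else f.2 x]).

Lemma flag_flipK k : involutive (flag_flip k).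
Proof.
case=> p s; congr pair; apply/ffunP => x; rewrite !ffunE /=.
by case: ifP => // ->; rewrite ?negbK.
Qed.

Lemma flag_alternating_flip b k f : k <= n -> subsphere_flag k f ->
  flag_alternating b k (flag_flip k f) = flag_alternating (~~ b) k f.
Proof.
move=> kn /subsphere_flagP fk.
rewrite /flag_alternating -alternating_labels_opp; last first.
  move=> x y /mapP[i]; rewrite mem_iota => ik -> /mapP[j]; rewrite mem_iota => jk ->.
  by apply: flag_label_compl; lia.
congr alternating_labels; rewrite -map_comp; apply/eq_in_map => i.
rewrite mem_iota => ik.
rewrite /= /flag_label -lam_opp ?flag_part_disjoint ?flag_part_neq0 //; try lia.
have E b' : flag_part (flag_flip k f) b' i.+1 = flag_part f (~~ b') i.+1.
  apply/setP => x; rewrite !inE ffunE /=; case: ifP => kx; first by case: (f.2 x); case: b'.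
  have [-> _] : f.1 x = x /\ f.2 x = true by apply: fk; rewrite leqNgt kx.
  by have -> : (x < i.+1) = false by lia.
by rewrite !E.
Qed.

(** For consecutive positions this changes one chain member and yields the other flag through an
    interior face. *)
Definition flag_swap (a b : 'I_n) (f : flag) : flag := ((f.1 * tperm a b)%g, f.2).

Lemma flag_swap_label (a b : 'I_n) f (i : nat) : b = a.+1 :> nat -> i != a ->
  flag_label (flag_swap a b f) i = flag_label f i.
Proof.
move=> ab ia; rewrite /flag_label.
suff E c : flag_part (flag_swap a b f) c i.+1 = flag_part f c i.+1 by rewrite !E.
apply/setP => x; rewrite !inE permM; congr (_ && _).
by case: tpermP => [->|->|] //; lia.
Qed.

(** Among the first [o + 1] chain members only the last one changes. *)
Definition flag_reflect (o : 'I_n) (f : flag) : flag :=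
  (f.1, [ffun x => if f.1 x == o then ~~ f.2 x else f.2 x]).

Lemma flag_reflect_label (o : 'I_n) f (i : nat) : i < o ->
  flag_label (flag_reflect o f) i = flag_label f i.
Proof.
move=> io; rewrite /flag_label.
suff E c : flag_part (flag_reflect o f) c i.+1 = flag_part f c i.+1 by rewrite !E.
apply/setP => x; rewrite !inE /= ffunE; case: ifP => // /eqP fxo; rewrite fxo.
by have -> : (o < i.+1) = false by lia.
Qed.

Lemma rem_iotaE j k : rem j (iota 0 k) = [seq i <- iota 0 k | i != j].
Proof. by rewrite rem_filter ?iota_uniq. Qed.

(* Counting pairs (flag of the upper hemisphere, face with alternating labels)
   in two ways; faces in the interior lie in two flags, those on the equator in one. *)
Lemma flag_alternating_step k : k < n ->
  \big[addb/false]_(f | subsphere_flag k.+1 f) flag_alternating true k.+1 f =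
  \big[addb/false]_(f | subsphere_flag k f) flag_alternating true k f.
Proof.
move=> kn; pose o := Ordinal kn.
pose H : pred flag := fun f => subsphere_flag k.+1 f && f.2 o.
(* The antipodal map carries the lower hemisphere to the upper one, [H], and exchanges the two
   starting signs. *)
transitivity (\big[addb/false]_(f in H)
    (flag_alternating true k.+1 f (+) flag_alternating false k.+1 f)).
  rewrite (bigID (fun f : flag => f.2 o)) /= big_split /=; congr (_ (+) _).
  rewrite (reindex_inj (inv_inj (flag_flipK k.+1))) /=.
  have sub f : subsphere_flag k.+1 (flag_flip k.+1 f) = subsphere_flag k.+1 f.
    by apply/subsphere_flagP/subsphere_flagP => fk x kx; have := fk x kx;
       rewrite /= ffunE ltnNge kx.
  apply: eq_big => f; first by rewrite sub ffunE /= ltnSn negbK.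
  by rewrite sub => /andP[fk _]; rewrite flag_alternating_flip.
transitivity (\big[addb/false]_(f in H) \big[addb/false]_(j <- iota 0 k.+1)
    alternating_labels true (map (flag_label f) (rem j (iota 0 k.+1)))).
  by apply: eq_bigr => f _; rewrite alternating_labels_rem.
have iotaS : iota 0 k.+1 = iota 0 k ++ [:: k] by rewrite -addn1 iotaD.
have remk : rem k (iota 0 k.+1) = iota 0 k.
  rewrite rem_iotaE iotaS filter_cat /= eqxx cats0; apply/all_filterP/allP => i.
  by rewrite mem_iota neq_ltn => /andP[_ ->].
rewrite exchange_big [X in \big[_/_]_(j <- X) _]iotaS big_cat big_seq1 remk.
(* A face omitting a member [j < k] is shared with the flag that swaps positions [j] and [j + 1]. *)
rewrite big_seq big1 => [|j]; last first.
  rewrite mem_iota => jk.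
  have jn : j < n by lia.
  have jn' : j.+1 < n by lia.
  apply: (@addb_involution_false _ H _ (flag_swap (Ordinal jn) (Ordinal jn'))).
  - by case=> p s _; rewrite /flag_swap /= -mulgA tperm2 mulg1.
  - move=> f /andP[/subsphere_flagP fk fo]; apply/andP; split=> //.
    apply/subsphere_flagP => x kx; have [E1 E2] := fk x kx; split=> //=.
    by rewrite permM E1 tpermD // -val_eqE /=; lia.
  - move=> f _; apply/eqP => /(congr1 (fun g => (f.1^-1 * g.1)%g)) /=.
    rewrite mulKg mulVg => /permP /(_ (Ordinal jn)); rewrite tpermL perm1.
    by move/(congr1 val) => /=; lia.
  - move=> f _; congr alternating_labels; rewrite rem_iotaE; apply/eq_in_map => i.
    by rewrite mem_filter => /andP[ij _]; rewrite flag_swap_label.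
(* For faces omitting the top member, reflection pairs the flags in which [o] does not enter last;
   the others are the flags of the equator. *)
rewrite (bigID (fun f : flag => f.1 o == o)) /= [X in _ (+) X](_ : _ = false) ?addbF; last first.
  apply: (@addb_involution_false _ [pred f | H f & f.1 o != o] _ (flag_reflect o)).
  - case=> p s _; congr pair; apply/ffunP => x; rewrite !ffunE /=.
    by case: eqP => //= _; rewrite negbK.
  - move=> f /andP[/andP[fk fo] fne]; rewrite inE; apply/andP; split=> //.
    have /subsphere_flagP fk' := fk.
    apply/andP; split; last by rewrite /= ffunE (negPf fne).
    apply/subsphere_flagP => x kx; have [E1 E2] := fk' x kx; split=> //=.
    by rewrite ffunE E1; case: eqP => // /(congr1 val) /=; lia.
  - move=> f _; apply/eqP => /(congr1 snd) /= /ffunP /(_ (f.1^-1 o)%g).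
    by rewrite ffunE permKV eqxx; case: (f.2 _).
  - move=> f _; congr alternating_labels; apply/eq_in_map => i; rewrite mem_iota => ik.
    by rewrite flag_reflect_label.
apply: eq_big => // f; rewrite /H unfold_in; apply/idP/idP.
  move=> /andP[/andP[/subsphere_flagP fk fo] /eqP fne]; apply/subsphere_flagP => x.
  by rewrite leq_eqVlt => /orP[/eqP kx|/fk//]; have -> : x = o by apply: val_inj.
move=> /subsphere_flagP fk; have [E1 E2] := fk o (leqnn k).
rewrite E1 E2 eqxx !andbT; apply/subsphere_flagP => x kx; apply: fk; lia.
Qed.

Lemma flag_alternating_odd k : k <= n ->
  \big[addb/false]_(f | subsphere_flag k f) flag_alternating true k f.
Proof.
elim: k => [_|k IH kn]; last by rewrite flag_alternating_step // IH // ltnW.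
rewrite (big_pred1 (1%g, [ffun=> true])) // => -[p s]; apply/subsphere_flagP/eqP => /= [H|].
  by congr pair; [apply/permP => x; rewrite perm1 | apply/ffunP => x; rewrite ffunE]; case: (H x).
by case=> -> -> x _; rewrite perm1 ffunE.
Qed.

Hypothesis lam_lt : forall A B : {set 'I_n}, [disjoint A & B] -> A :|: B != set0 ->
  lam A B < m.*2.

(** The odd count gives a flag with [n] alternating labels, whose absolute values are distinct and
    below [m]. *)
Lemma octahedral_tucker : n <= m.
Proof.
have : [exists f, flag_alternating true n f].
  rewrite -[X in is_true X]negbK; apply/negP; rewrite negb_exists => /forallP nalt.
  by have := flag_alternating_odd (leqnn n); rewrite big1 // => f _; apply: negPf.
case/existsP => f /alternating_labels_size; rewrite size_map size_iota; apply.
  move=> x y /mapP[i]; rewrite mem_iota => ik -> /mapP[j]; rewrite mem_iota => jk ->.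
  by apply: flag_label_compl; lia.
move=> x /mapP[i]; rewrite mem_iota => ik ->.
by apply: lam_lt; [apply: flag_part_disjoint | apply: flag_part_neq0; lia].
Qed.

End Tucker.

(** * Lovasz's theorem on Kneser graphs *)

Section Kneser.
Variables (n k m : nat) (col : {set 'I_n} -> nat).
Hypothesis k_gt0 : 0 < k.
Hypothesis col_lt : forall A : {set 'I_n}, #|A| = k -> col A < m.
Hypothesis col_proper : forall A B : {set 'I_n}, #|A| = k -> #|B| = k ->
  [disjoint A & B] -> col A != col B.

Definition contains_color (i : nat) (A : {set 'I_n}) : bool :=
  [exists K : {set 'I_n}, [&& K \subset A, #|K| == k & col K == i]].

Definition least_color (A B : {set 'I_n}) : nat :=
  find (fun i => contains_color i A || contains_color i B) (iota 0 m).

(* Small pairs are labelled by their size; there the sign only has to be antisymmetric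
   in the two sets, so any total order on sets may decide it. *)
Definition kneser_label (A B : {set 'I_n}) : nat :=
  if #|A| + #|B| <= 2 * k - 2
  then (enum_rank A < enum_rank B) + (#|A| + #|B|).-1.*2
  else contains_color (least_color A B) A + (2 * k - 2 + least_color A B).*2.

Lemma contains_color_some (A : {set 'I_n}) : k <= #|A| -> exists2 i, i < m & contains_color i A.
Proof.
move=> /card_geqP[s [us ss sA]]; have cs : #|[set x in s]| = k.
  by rewrite cardsE (card_uniqP us).
exists (col [set x in s]); first exact: col_lt.
apply/existsP; exists [set x in s]; rewrite cs !eqxx !andbT.
by apply/subsetP => x; rewrite inE => /sA.
Qed.

Lemma contains_color_sub i (A A' : {set 'I_n}) :
  A \subset A' -> contains_color i A -> contains_color i A'.
Proof.
move=> sAA' /existsP[K /andP[sKA H]]; apply/existsP; exists K.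
by rewrite (subset_trans sKA).
Qed.

Lemma contains_color_disjoint i (A B : {set 'I_n}) : [disjoint A & B] ->
  contains_color i A -> contains_color i B -> False.
Proof.
move=> dAB /existsP[K /and3P[KA /eqP cK /eqP iK]] /existsP[L /and3P[LB /eqP cL /eqP iL]].
have /eqP := col_proper cK cL (disjointWl KA (disjointWr LB dAB)).
by rewrite iK iL.
Qed.

Lemma least_colorP (A B : {set 'I_n}) : 2 * k - 2 < #|A| + #|B| ->
  least_color A B < m /\
  contains_color (least_color A B) A || contains_color (least_color A B) B.
Proof.
move=> large.
have H : has (fun i => contains_color i A || contains_color i B) (iota 0 m).
  have [kA|kB] : k <= #|A| \/ k <= #|B| by lia.
    by have [i im Ai] := contains_color_some kA; apply/hasP; exists i; rewrite ?mem_iota ?Ai.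
  by have [i im Ai] := contains_color_some kB; apply/hasP; exists i; rewrite ?mem_iota ?Ai ?orbT.
have lt : least_color A B < m by move: H; rewrite has_find size_iota.
by split=> //; have := nth_find 0 H; rewrite nth_iota.
Qed.

Lemma least_colorC A B : least_color A B = least_color B A.
Proof. by apply: eq_find => i; rewrite orbC. Qed.

Lemma opp_label_bool (b : bool) a : opp_label (b + a.*2) = ~~ b + a.*2.
Proof. by rewrite /opp_label oddD odd_double addbF; case: b. Qed.

(** The absolute values are [2 * k - 2] sizes and [m] colours. Nested pairs with opposite labels of
    size type would coincide; of colour type, they would put [k]-sets of one colour into both of the
    disjoint sets [A'] and [B']. *)
Lemma kneser : n <= 2 * k - 2 + m.
Proof.
apply: (@octahedral_tucker _ _ kneser_label).
- move=> A B dAB AB0; rewrite /kneser_label [#|B| + _]addnC least_colorC.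
  case: ifP => small; rewrite opp_label_bool; congr (nat_of_bool _ + _).
    have ne : A != B.
      apply: contra AB0 => /eqP eAB; move: dAB; rewrite eAB -setI_eq0 setIid setUid.
      by [].
    by rewrite -leqNgt [RHS]leq_eqVlt val_eqE (inj_eq enum_rank_inj) eq_sym (negPf ne).
  have [|_] := @least_colorP A B; first by lia.
  have := @contains_color_disjoint (least_color A B) _ _ dAB.
  by case: contains_color; case: contains_color => //= /(_ isT isT).
- move=> A B A' B' sA sB dAB' AB0.
  have dAB : [disjoint A & B] := disjointWl sA (disjointWr sB dAB').
  have AB_gt0 : 0 < #|A| + #|B| by rewrite -cardsUI; have := AB0; rewrite -card_gt0; lia.
  have leA := subset_leq_card sA; have leB := subset_leq_card sB.
  rewrite /kneser_label; case: ifP => small'; case: ifP => small; rewrite opp_label_bool.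
  + move=> E.
    have eA : A = A' by apply/eqP; rewrite eqEcard sA; lia.
    have eB : B = B' by apply/eqP; rewrite eqEcard sB; lia.
    by move: E; rewrite eA eB; lia.
  + by lia.
  + move: small AB_gt0; set x := #|A| + #|B| => small x_gt0.
    by case: contains_color; case: (enum_rank A < _) => /=; lia.
  + set i := least_color A B; set i' := least_color A' B' => E.
    have ei : i' = i by lia.
    have [|_] := @least_colorP A' B'; first by lia.
    have [|_] := @least_colorP A B; first by lia.
    move: E; rewrite -/i -/i' ei => E.
    case: (boolP (contains_color i A)) E => [Ai|_] /= E Bi.
      have := @contains_color_disjoint i _ _ dAB' (contains_color_sub sA Ai).
      by case: (contains_color i B') E; case: (contains_color i A') => //=; lia.
    have A'i : contains_color i A' by lia.
    by have := contains_color_disjoint dAB' A'i (contains_color_sub sB Bi).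
- move=> A B dAB AB0; rewrite /kneser_label; case: ifP => small.
    have AB_gt0 : 0 < #|A| + #|B|.
      by rewrite -cardsUI; have := AB0; rewrite -card_gt0; lia.
    move: small AB_gt0; set x := #|A| + #|B| => small x_gt0.
    by case: (enum_rank A < _) => /=; lia.
  have [|lt _] := @least_colorP A B; first by lia.
  by case: contains_color => /=; lia.
Qed.
End Kneser.

(** * Shitov's argument *)

Lemma exp_graphP (T : finType) (e : rel T) m (f g : {ffun T -> 'I_m}) : symmetric e ->
  reflect (forall x y, e x y -> f x != g y) (exp_graph e m f g).
Proof.
move=> sym; apply: (iffP idP) => [/forallP H x y exy|H].
  by have /forallP/(_ y) := H x; rewrite exy => /andP[].
by apply/forallP => x; apply/forallP => y; apply/implyP => exy; rewrite !H // sym.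
Qed.

Lemma colorableP (T : finType) (e : rel T) k :
  reflect (exists f : T -> 'I_k, forall x y, e x y -> f x != f y) (colorable e k).
Proof.
apply: (iffP existsP) => [[f /forallP H]|[f H]].
  by exists f => x y exy; have /forallP/(_ y) := H x; rewrite exy.
exists (finfun f); apply/forallP => x; apply/forallP => y; apply/implyP => exy.
by rewrite !ffunE H.
Qed.

Lemma lex_Kq_sym (T : finType) (e : rel T) q : symmetric e -> symmetric (lex_Kq e q).
Proof. by move=> sym x y; rewrite /lex_Kq sym eq_sym [in X in _ && X]eq_sym. Qed.

(* A random map works: each of the 2 |V|^2 coincidences has probability 1/c. *)
Lemma exists_avoiding_map (V : finType) c (t : V -> 'I_c -> 'I_c) : 2 * #|V| ^ 2 < c ->
  exists f : {ffun V -> 'I_c}, forall u v, u != v -> f u != f v /\ f u != t v (f v).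
Proof.
move=> cV; pose F : finType := ({ffun V -> 'I_c} : finType).
pose bad (u v : V) (h : 'I_c -> 'I_c) := [set f : F | (u != v) && (f u == h (f v))].
have card_bad u v h : #|bad u v h| * c <= #|F|.
  have [->|ne_uv] := eqVneq u v.
    by rewrite (_ : bad v v h = set0) ?cards0 //; apply/setP => f; rewrite !inE eqxx.
  (* In [bad u v h] the value at [u] is determined by the one at [v], so overwriting it by any
     colour is injective. *)
  pose upd (p : F * 'I_c) : F := [ffun x => if x == u then p.2 else p.1 x].
  have <- : #|setX (bad u v h) [set: 'I_c]| = #|bad u v h| * c.
    by rewrite cardsX cardsT card_ord.
  rewrite -(@card_in_imset _ _ upd); first exact: max_card.
  move=> [f i] [g j]; rewrite !inE /=.
  move=> /andP[/andP[_ /eqP fu] _] /andP[/andP[_ /eqP gu] _] /ffunP E.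
  have eij : i = j by have := E u; rewrite !ffunE eqxx.
  have efg x : x != u -> f x = g x by move=> xu; have := E x; rewrite !ffunE (negPf xu).
  congr pair => //; apply/ffunP => x; have [->|/efg//] := eqVneq x u.
  by rewrite fu gu efg // eq_sym.
pose B := \bigcup_(p : V * V) (bad p.1 p.2 id :|: bad p.1 p.2 (t p.2)).
have cB : #|B| * c <= 2 * #|V| ^ 2 * #|F|.
  have : #|B| <= \sum_(p : V * V) (#|bad p.1 p.2 id| + #|bad p.1 p.2 (t p.2)|).
    rewrite /B; elim/big_rec2: _ => [|p y A _ IH]; first by rewrite cards0.
    apply: (leq_trans (leq_card_setU _ _)); apply: leq_add => //; exact: leq_card_setU.
  rewrite -(leq_pmul2r (_ : 0 < c)) => [/leq_trans->//|]; last by lia.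
  rewrite big_distrl /= (leq_trans (_ : _ <= \sum_(p : V * V) (2 * #|F|))) //.
    by apply: leq_sum => p _; rewrite mulnDl mul2n -addnn leq_add.
  by rewrite sum_nat_const card_prod mulnn mulnCA mulnA.
have Fgt0 : 0 < #|F| by rewrite card_ffun card_ord expn_gt0; lia.
have [f fB] : exists f, f \notin B.
  apply/existsP; rewrite -negb_forall; apply/negP => /forallP allB.
  have BF : #|B| = #|F| by apply: eq_card => f; rewrite allB.
  by move: cB; rewrite BF mulnC leq_pmul2r // leqNgt cV.
exists f => u v ne_uv; move: fB; rewrite /B; move/bigcupP => nB.
by split; apply/negP => fuv; apply: nB; exists (u, v) => //; rewrite !inE ne_uv fuv ?orbT.
Qed.

Section Shitov.
Variables (V : finType) (e : rel V) (q : nat).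
Hypotheses (e_sym : symmetric e) (e_irr : irreflexive e) (e_girth : girth_ge6 e).
Let c := (4 * q + 2)%N.
Local Notation Gq := (lex_Kq e q).
Local Notation Kexp := (exp_graph Gq c).

Lemma no_triangle x y z : e x y -> e y z -> e z x -> False.
Proof.
move=> xy yz zx; have := @e_girth [:: x; y; z]; rewrite /= xy yz zx !inE negb_or.
have ne u v : e u v -> u != v by move=> uv; apply: contraTneq uv => ->; rewrite e_irr.
by rewrite (ne x y) // (ne y z) // [x == z]eq_sym (ne z x) //= => /(_ isT isT).
Qed.

(** The non-adjacencies and the absence of triangles make the five vertices distinct. *)
Lemma no_pentagon v w x y z : e v w -> e w x -> e x y -> e y z -> e z v ->
  v != x -> v != y -> ~~ e v x -> ~~ e v y -> False.
Proof.
move=> vw wx xy yz zv vx vy evx evy.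
have ne a b : e a b -> a != b by move=> ab; apply: contraTneq ab => ->; rewrite e_irr.
have wz : w != z by apply/eqP => wz; subst z; exact: (no_triangle wx xy yz).
have wy : w != y by apply: contraNneq evy => <-.
have xz : x != z by apply: contraNneq evx => ->; rewrite e_sym.
have := @e_girth [:: v; w; x; y; z]; rewrite /= vw wx xy yz zv !inE !negb_or.
rewrite (ne v w) // vx vy [v == z]eq_sym (ne z v) // (ne w x) // wy wz (ne x y) // xz (ne y z) //=.
by move=> /(_ isT isT).
Qed.

Definition lift_map (f : V -> 'I_c) : {ffun V * 'I_q -> 'I_c} := [ffun p => f p.1].

Variable Psi : {ffun V * 'I_q -> 'I_c} -> 'I_c.
Hypothesis Psi_proper : forall f g, Kexp f g -> Psi f != Psi g.
Hypothesis Psi_const : forall a, Psi [ffun=> a] = a.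

Let Gq_sym : symmetric Gq := lex_Kq_sym e_sym (q := q).

(** Otherwise [f] is adjacent to the constant map with value [Psi f], which has the same colour. *)
Lemma Psi_image f : exists x, Psi f = f x.
Proof.
apply/'exists_eqP; rewrite -[X in is_true X]negbK negb_exists; apply/negP => /forallP H.
have : Kexp f [ffun=> Psi f].
  by apply/(exp_graphP _ _ Gq_sym) => x y _; rewrite ffunE eq_sym H.
by move/Psi_proper; rewrite Psi_const eqxx.
Qed.

Definition in_ball v x := (x == v) || e v x.
Definition two_valued v (s t : 'I_c) := lift_map (fun x => if in_ball v x then t else s).

(* Otherwise each (v, s) has a t such that two_valued v s t is coloured s; a generic map f,
   coloured f v, is then adjacent to the map two_valued v (f v) t. *)
Lemma exists_robust : 2 * #|V| ^ 2 < c ->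
  exists v s, forall t, t != s -> Psi (two_valued v s t) != s.
Proof.
move=> cV.
case: (boolP [exists v, exists s, forall t, (t != s) ==> (Psi (two_valued v s t) != s)]).
  by case/existsP => v /existsP[s /forallP H]; exists v, s => t; apply/implyP.
rewrite negb_exists => /forallP nH; exfalso.
pose t v s : 'I_c := odflt s [pick t | (t != s) && (Psi (two_valued v s t) == s)].
have tP v s : t v s != s /\ Psi (two_valued v s (t v s)) = s.
  have := nH v; rewrite negb_exists => /forallP/(_ s); rewrite negb_forall => /existsP[u].
  rewrite negb_imply negbK => Hu; rewrite /t; case: pickP => [w /andP[-> /eqP]|/(_ u)] //.
  by rewrite Hu.
have [f fP] := exists_avoiding_map t cV.
have [[v i] Ev] := Psi_image (lift_map f); rewrite ffunE /= in Ev.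
have [ts Et] := tP v (f v).
have : Kexp (lift_map f) (two_valued v (f v) (t v (f v))).
  apply/(exp_graphP _ _ Gq_sym) => x y xy; rewrite !ffunE.
  (* Over [v] all neighbours lie in the ball, where the value is not [f v]; elsewhere [f] avoids
     both values. *)
  have [Ex|ne] := eqVneq x.1 v; last by have [H1 H2] := fP _ _ ne; case: ifP.
  rewrite Ex (_ : in_ball v y.1) 1?eq_sym //; rewrite /in_ball.
  by case/orP: xy => [|/andP[/eqP <- _]]; rewrite Ex ?eqxx // => ->; rewrite orbT.
by move/Psi_proper; rewrite Ev Et eqxx.
Qed.

(* The distance to v, truncated at 3. *)
Definition level v x : nat :=
  if x == v then 0 else if e v x then 1 else if [exists w, e v w && e w x] then 2 else 3.

(** Within distance 2, an edge inside level 1 closes a triangle and one inside level 2 a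
    pentagon. *)
Lemma level_edge v x y : e x y -> level v x != 3 -> level v y != 3 ->
  (level v x == 1) != (level v y == 1).
Proof.
move=> xy; rewrite /level; case: (eqVneq x v) => [xv|xv].
  rewrite -xv xy; case: (eqVneq y x) => // yx.
  by rewrite yx e_irr in xy.
case: (eqVneq y v) => [yv|yv]; first by rewrite -yv e_sym xy.
case: (boolP (e v x)) => vx; case: (boolP (e v y)) => vy; try by case: ifP.
  by case: (no_triangle vx xy); rewrite e_sym.
case: (boolP [exists w, e v w && e w x]) => [/existsP[w /andP[vw wx]] _|]; last by [].
case: (boolP [exists w, e v w && e w y]) => [/existsP[z /andP[vz zy]] _|]; last by [].
by case: (@no_pentagon v w x y z); rewrite // ?vx ?vy // 1?eq_sym // e_sym.
Qed.

Lemma level_near v x y : e x y || (x == y) -> in_ball v x -> level v y < 3.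
Proof.
rewrite /level /in_ball => xy bx; case: eqP => // /eqP yv; case: ifP => // vy.
case: ifP => // /negbT/negP[]; apply/existsP; exists x.
case/orP: bx => [/eqP Ex|vx].
  by move: xy; rewrite Ex vy eq_sym (negPf yv).
by rewrite vx; case/orP: xy => // /eqP E; rewrite E vy in vx.
Qed.

(* The maps phi t use 2q palette colours within distance 2 of v and t further away, and are
   pairwise adjacent by the girth condition; having more than 2q of them, some phi t is
   coloured t.  It is adjacent to two_valued v s t, whose colour must also be t. *)
Lemma robust_absurd v s : (forall t, t != s -> Psi (two_valued v s t) != s) -> False.
Proof.
move=> rob.
have pal_lt (b : bool) (i : 'I_q) : b * q + i < c.-1.
  by rewrite /c; have := ltn_ord i; case: b; lia.
(* Two disjoint blocks of [q] colours, both avoiding [s]: one for level 1, one for levels 0 and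
   2. *)
pose pal (b : bool) (i : 'I_q) : 'I_c := lift s (Ordinal (pal_lt b i)).
have pal_inj b i b' i' : pal b i = pal b' i' -> b = b' /\ i = i'.
  move/lift_inj => /(congr1 val) /= E; have := ltn_ord i; have := ltn_ord i'.
  by case: b E; case: b' => E *; split=> //; try apply: val_inj => /=; lia.
pose P := [set pal p.1 p.2 | p : bool * 'I_q].
have palP b i : pal b i \in P by apply/imsetP; exists (b, i).
have cP : #|P| <= 2 * q.
  by rewrite (leq_trans (leq_imset_card _ _)) // card_prod card_bool card_ord.
have sP : s \notin P by apply/imsetP => -[[b i] _] /eqP; rewrite (negPf (neq_lift _ _)).
pose phi (t : 'I_c) : {ffun V * 'I_q -> 'I_c} :=
  [ffun p => if level v p.1 == 3 then t else pal (level v p.1 == 1) p.2].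
pose T := ~: (s |: P).
(* At least [c - 1 - 2 * q = 2 * q + 1] colours remain. *)
have cT : 2 * q < #|T|.
  by rewrite cardsCs setCK cardsU1 sP card_ord /=; move: cP; rewrite /c; set x := #|P|; lia.
have phi_adj t u : t \in T -> u \in T -> t != u -> Psi (phi t) != Psi (phi u).
  move=> tT uT ne; apply: Psi_proper; apply/(exp_graphP _ _ Gq_sym) => x y xy.
  have TP w b i : w \in T -> w != pal b i.
    by rewrite !inE => /norP[_]; apply: contraNneq => ->.
  rewrite !ffunE; case: ifP => lx; case: ifP => ly //; first exact: TP.
    by rewrite eq_sym; exact: TP.
  apply/eqP => /pal_inj[El Ei].
  case/orP: xy => [xy|/andP[/eqP Exy]]; last by rewrite Ei eqxx.
  by have := level_edge (v := v) xy; rewrite lx ly El eqxx => /(_ isT isT).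
have [t tT Et] : exists2 t, t \in T & Psi (phi t) = t.
  suff /exists_inP[t tT /eqP Et] : [exists t in T, Psi (phi t) == t] by exists t.
  rewrite -[X in is_true X]negbK negb_exists_in; apply/negP => /forall_inP H.
  (* If no [phi t] has colour [t], all their colours are in [P], which is too small. *)
  have sub : [set Psi (phi t) | t in T] \subset P.
    apply/subsetP => _ /imsetP[t tT ->]; have [p Ep] := Psi_image (phi t).
    have := H t tT; rewrite Ep ffunE; by case: ifP => //; rewrite eqxx.
  have phi_inj : {in T &, injective (fun t => Psi (phi t))}.
    by move=> t u tT uT /eqP E; apply/eqP; apply: contraLR E => /phi_adj; apply.
  have := leq_trans (subset_leq_card sub) cP.
  by rewrite (card_in_imset phi_inj) leqNgt cT.
have [ts tP] : t != s /\ t \notin P by move: tT; rewrite !inE => /norP.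
have Epsi : Psi (two_valued v s t) = t.
  have [p Ep] := Psi_image (two_valued v s t); have := rob t ts; rewrite Ep ffunE.
  by case: ifP => //; rewrite eqxx.
(* Neighbours of the ball are within distance 2, where [phi t] avoids [t]; and [phi t] never takes
   the value [s]. *)
have : Kexp (two_valued v s t) (phi t).
  apply/(exp_graphP _ _ Gq_sym) => x y xy; rewrite !ffunE; case: ifP => bx.
    rewrite ifN; first by apply: contraNneq tP => ->.
    have := @level_near v x.1 y.1; rewrite bx; case/orP: xy => [->|/andP[/eqP-> _]].
      by move/(_ isT isT); case: (level v y.1) => [|[|[]]].
    by rewrite eqxx orbT => /(_ isT isT); case: (level v y.1) => [|[|[]]].
  by case: ifP => _; [rewrite eq_sym | apply: contraNneq sP => ->].
by move/Psi_proper; rewrite Epsi Et eqxx.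
Qed.
End Shitov.

(** The constant maps form a clique, so a colouring permutes the [c] colours on them; undoing this
    permutation gives the normalised [Phi]. *)
Lemma exp_graph_not_colorable (V : finType) (e : rel V) q c : simple_graph e -> girth_ge6 e ->
  c = 4 * q + 2 -> 2 * #|V| ^ 2 < c -> ~~ colorable (exp_graph (lex_Kq e q) c) c.
Proof.
move=> [e_sym e_irr] girth -> cV; apply/negP => /colorableP[Psi Psi_proper].
pose kap a := Psi [ffun=> a].
have kap_inj : injective kap.
  move=> a b /eqP E; apply/eqP; apply: contraLR E => ab; apply: Psi_proper.
  by apply/(exp_graphP _ _ (lex_Kq_sym e_sym (q := q))) => x y _; rewrite !ffunE.
pose Phi f := invF kap_inj (Psi f).
have Phi_proper f g : exp_graph (lex_Kq e q) (4 * q + 2) f g -> Phi f != Phi g.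
  by move/Psi_proper; apply: contraNneq => /(can_inj (f_invF kap_inj))->.
have Phi_const a : Phi [ffun=> a] = a by exact: (invF_f kap_inj).
have [v [s rob]] := exists_robust e_sym Phi_proper Phi_const cV.
exact: (robust_absurd e_sym e_irr girth Phi_proper Phi_const rob).
Qed.

(** * Chromatic numbers *)

(** Counts with multiplicity, since different colour classes may have the same projection. *)
Lemma sum_eq_classes (I T : finType) (cls : I -> T) (Q : pred T) :
  \sum_(A | Q A) \sum_(j : I) (A == cls j) = \sum_(j : I) Q (cls j).
Proof.
rewrite exchange_big; apply: eq_bigr => j _.
rewrite big_mkcond (bigD1 (cls j)) //= eqxx big1 ?addn0 => [|A /negPf->]; by case: (Q _).
Qed.

(* Each colour class of G[K_q] projects to an independent set of G, and every vertex
   lies in q of these projections. *)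
Lemma frac_chi_lex_Kq (V : finType) (e : rel V) q k (r : rat) : 0 < q ->
  frac_chi_ge e r -> colorable (lex_Kq e q) k -> (r * q%:R <= k%:R)%R.
Proof.
move=> q_gt0 er /colorableP[f f_proper].
have q0 : (0 < q%:R :> rat)%R by rewrite ltr0n.
pose cls (j : 'I_k) := [set x | [exists i, f (x, i) == j]].
pose w : {ffun {set V} -> rat} :=
  [ffun A : {set V} => (\sum_(j : 'I_k) (A == cls j))%:R / q%:R]%R.
have sum_w (Q : pred {set V}) :
    (\sum_(A | Q A) w A = (\sum_(j : 'I_k) Q (cls j))%:R / q%:R)%R.
  rewrite -sum_eq_classes natr_sum mulr_suml; apply: eq_bigr => A _; exact: ffunE.
have /er : frac_coloring e w.
  split=> [A|]; first by rewrite ffunE mulr_ge0 ?invr_ge0 ?ler0n.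
  split=> [A|x].
    rewrite ffunE mulf_eq0 negb_or pnatr_eq0 sum_nat_eq0 negb_forall.
    case/andP=> /existsP[j]; case: (A =P cls j) => [-> _ _|]; rewrite ?eqxx //.
    apply/forall_inP => x; rewrite inE => /existsP[i /eqP xi].
    apply/forall_inP => y; rewrite inE => /existsP[i' /eqP yi].
    apply/negP => xy; have := f_proper (x, i) (y, i'); rewrite /lex_Kq /= xy => /(_ isT).
    by rewrite xi yi eqxx.
  rewrite sum_w ler_pdivlMr // mul1r ler_nat.
  (* The copies of [x] form a clique, so [x] lies in the projections of [q] classes. *)
  have inj : injective (fun i => f (x, i)).
    move=> i i' E; apply/eqP; apply: contraT => ne.
    by have := f_proper (x, i) (x, i'); rewrite /lex_Kq /= eqxx ne orbT E eqxx => /(_ isT).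
  rewrite -[X in X <= _](card_ord q) -(card_codom inj) -sum1_card big_mkcond /=.
  apply: leq_sum => j _; case: ifP => // /codomP[i ->].
  by rewrite inE (_ : [exists _, _]) //; apply/existsP; exists i.
rewrite sum_w ler_pdivlMr // => /le_trans; apply; rewrite ler_nat.
by rewrite sum1_card card_ord.
Qed.

Lemma exp_graph_sym (T : finType) (e : rel T) m : symmetric (exp_graph e m).
Proof.
move=> f g; apply: eq_forallb => x; apply: eq_forallb => y.
by rewrite andbC eq_sym [f x == _]eq_sym.
Qed.

(** A loop at [f] says that [f] is a proper colouring. *)
Lemma exp_graph_irr (T : finType) (e : rel T) m :
  ~~ colorable e m -> irreflexive (exp_graph e m).
Proof.
move=> ncol f; apply: contraNF ncol => /forallP H; apply/colorableP; exists f => x y exy.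
by have /forallP/(_ y) := H x; rewrite exy => /andP[].
Qed.

(** Evaluation colours the product. *)
Lemma prod_exp_colorable (T : finType) (e : rel T) m :
  colorable (prod_graph e (exp_graph e m)) m.
Proof.
apply/colorableP; exists (fun p : T * {ffun T -> 'I_m} => p.2 p.1).
move=> -[x f] [y g] /andP[/= xy /forallP H].
by have /forallP/(_ y) := H x; rewrite xy => /andP[].
Qed.

Section Extension.
Variables (T : finType) (e : rel T) (n c k : nat).
Hypotheses (e_sym : symmetric e) (ncol : ~~ colorable (exp_graph e c) c).
Variable Psi : {ffun T -> 'I_n} -> 'I_k.
Hypothesis Psi_proper : forall f g, exp_graph e n f g -> Psi f != Psi g.

Definition const_color (a : 'I_n) := Psi [ffun=> a].

Lemma const_color_inj : injective const_color.
Proof.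
move=> a b /eqP E; apply/eqP; apply: contraLR E => ab; apply: Psi_proper.
by apply/(exp_graphP _ _ e_sym) => x y _; rewrite !ffunE.
Qed.

(** Otherwise every map into [S] shares its colour with a constant map, whose value lies in [S]
    since it would be adjacent otherwise. This gives a [c]-colouring contradicting [ncol]. *)
Lemma exists_new_color (S : {set 'I_n}) : #|S| = c ->
  exists f : {ffun T -> 'I_n}, (forall x, f x \in S) /\ Psi f \notin codom const_color.
Proof.
move=> cS; suff /existsP[f /andP[/forallP]] : [exists f : {ffun T -> 'I_n},
  [forall x, f x \in S] && (Psi f \notin codom const_color)] by exists f.
apply: contraT; rewrite negb_exists => /forallP H; case/negP: ncol; rewrite -cS.
pose emb (f : {ffun T -> 'I_#|S|}) : {ffun T -> 'I_n} := [ffun x => enum_val (f x)].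
have emb_col f : exists a : 'I_#|S|, Psi (emb f) = const_color (enum_val a).
  have embS x : emb f x \in S by rewrite ffunE enum_valP.
  have := H (emb f); rewrite negb_and negbK (_ : [forall x, emb f x \in S]) /=; last exact/forallP.
  case/codomP => b Eb; have bS : b \in S.
    apply: contraT => bS; have : exp_graph e n (emb f) [ffun=> b].
      apply/(exp_graphP _ _ e_sym) => x y _; rewrite [X in _ != X]ffunE.
      by apply: contraNneq bS => <-.
    by move/Psi_proper; rewrite Eb eqxx.
  by exists (enum_rank_in bS b); rewrite enum_rankK_in.
have [Phi PhiP] := fin_all_exists emb_col.
apply/colorableP; exists Phi => f g fg.
have : exp_graph e n (emb f) (emb g).
  apply/(exp_graphP _ _ e_sym) => x y xy; rewrite !ffunE (inj_eq enum_val_inj).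
  by move/(exp_graphP _ _ e_sym): fg; apply.
by move/Psi_proper; rewrite !PhiP; apply: contraNneq => ->.
Qed.

Lemma exp_graph_colors : 0 < n -> 0 < c -> 2 * n + 2 <= k + 2 * c.
Proof.
move=> n_gt0 c_gt0; pose Sec := ~: [set y in codom const_color].
have F_ex (S : {set 'I_n}) : exists f : {ffun T -> 'I_n}, #|S| = c ->
    (forall x, f x \in S) /\ Psi f \in Sec.
  have [/exists_new_color[f [fS fP]]|ne] := eqVneq #|S| c.
    by exists f; split=> //; rewrite !inE.
  (* An arbitrary map serves for sets of other sizes. *)
  by exists [ffun=> Ordinal n_gt0] => E; rewrite E eqxx in ne.
have [F FP] := fin_all_exists F_ex.
have cSec : n + #|Sec| = k.
  rewrite -[RHS]card_ord -(cardsC [set y in codom const_color]); congr (_ + _).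
  by rewrite cardsE; exact/esym/(etrans (card_codom const_color_inj))/card_ord.
(* Here [Sec] has [k - n] colours, and the new colours properly colour the Kneser graph of
   [c]-sets. *)
suff : n <= 2 * c - 2 + #|Sec| by move: cSec; set x := #|Sec|; lia.
apply: (@kneser n c #|Sec| (fun S => index (Psi (F S)) (enum Sec)) c_gt0) =>
  [A /FP[_ AS]|A B cA cB dAB].
  by rewrite cardE index_mem mem_enum.
have [FA AS] := FP _ cA; have [FB BS] := FP _ cB.
have neq : Psi (F A) != Psi (F B).
  apply: Psi_proper; apply/(exp_graphP _ _ e_sym) => x y _.
  by apply: contraTneq (FA x) => ->; rewrite (disjointFl dAB).
apply: contra neq => /eqP E; apply/eqP.
rewrite -(nth_index (Psi (F A)) (_ : Psi (F A) \in enum Sec)) ?mem_enum //.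
by rewrite E nth_index ?mem_enum.
Qed.
End Extension.

(** * The chromatic bounds and the product *)

Theorem theorem7 (d : nat) (V : finType) (e : rel V) (q c : nat) :
  1 <= d -> simple_graph e -> girth_ge6 e ->
  frac_chi_ge e ((81%:R / 10%:R) * d%:R)%R ->
  2 ^ (#|V| - 1) * #|V| ^ 2 <= q -> c = 4 * q + 2 ->
  [/\ chi_ge (lex_Kq e q) (2 * d * c - 2 * c + 2),
      chi_ge (exp_graph (lex_Kq e q) (d * c)) (2 * d * c - 2 * c + 2) &
      poljak_rodl_le (2 * d * c - 2 * c + 2) (d * c)].
Proof.
move=> d_gt0 e_simple girth chi_f qV cq; have [e_sym e_irr] := e_simple.
have chi_q q' k : 0 < q' -> colorable (lex_Kq e q') k -> 81 * d * q' <= 10 * k.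
  move=> q'_gt0 /(frac_chi_lex_Kq q'_gt0 chi_f).
  rewrite mulrAC -!mulrA [(_^-1 * _)%R]mulrC !mulrA ler_pdivrMr ?ltr0n //.
  by rewrite -!natrM ler_nat mulnAC [k * _]mulnC.
(* The case [q' = 1], with all vertices coloured differently, bounds [#|V|] from below. *)
have p_ge : 81 * d <= 10 * #|V|.
  rewrite -[81 * d]muln1; apply: chi_q => //; apply/colorableP.
  exists (fun p => enum_rank p.1) => x y; rewrite (inj_eq enum_rank_inj) /lex_Kq.
  rewrite (ord1 x.2) (ord1 y.2) eqxx andbF orbF => xy.
  by apply: contraTneq xy => ->; rewrite e_irr.
have qp : #|V| ^ 2 <= q by apply: leq_trans qV; rewrite leq_pmull // expn_gt0.
have pp : #|V| <= #|V| ^ 2 by rewrite leq_pmull //; lia.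
have dc : d * c = 4 * (d * q) + 2 * d by rewrite cq; lia.
have dq : d <= d * q by rewrite leq_pmulr //; lia.
have n_eq : 2 * d * c - 2 * c + 2 = 2 * (d * c) - 2 * c + 2 by rewrite mulnA.
have chi_lex : chi_ge (lex_Kq e q) (2 * d * c - 2 * c + 2).
  (* Here [10 * k] is at most [80 * d * q + 40 * d - 80 * q - 30], less than [81 * d * q] because
     [q] is at least [8.1 * d]. *)
  move=> k; rewrite n_eq dc => lt_k; apply/negP => /chi_q; rewrite -mulnA; lia.
(* This makes the exponential graph loopless. *)
have ncol : ~~ colorable (lex_Kq e q) (d * c).
  by apply/negP => /chi_q; rewrite dc -mulnA; lia.
have lex_sym := @lex_Kq_sym _ e q e_sym.
have chi_exp : chi_ge (exp_graph (lex_Kq e q) (d * c)) (2 * d * c - 2 * c + 2).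
  move=> k lt_k; apply/negP => /colorableP[Psi Psi_proper].
  have ncc : ~~ colorable (exp_graph (lex_Kq e q) c) c.
    by apply: exp_graph_not_colorable => //; lia.
  have cdc : c <= d * c by rewrite leq_pmull.
  have := exp_graph_colors lex_sym ncc Psi_proper; move: lt_k; rewrite n_eq; lia.
split=> //; exists (V * 'I_q)%type, {ffun V * 'I_q -> 'I_(d * c)}.
exists (lex_Kq e q), (exp_graph (lex_Kq e q) (d * c)).
split=> //; last exact: prod_exp_colorable.
  by split=> // x; rewrite /lex_Kq e_irr eqxx eqxx andbF.
split; [exact: exp_graph_sym | exact: exp_graph_irr].
Qed.
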